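(* Let $M$ be a melon graph such that the line graph $L(M)$ is word-representable. Then $\mathcal{R}(L(M))\le 3$. Furthermore, $\mathcal{R}(L(M))=3$ if and only if at least three of the constituent paths of $M$ have length at least two.
   Context: All graphs are finite and simple. A melon graph $M=(E_1,\ldots,E_m)$ ($m\ge 1$) is the graph formed as the union of $m$ paths $E_1,\ldots,E_m$ (the constituent paths), all having the same two distinct endpoints $0$ and $0'$, and pairwise sharing no vertices other than $0$ and $0'$; since $M$ is simple, at most one constituent path has length one (length = number of edges). The line graph $L(G)$ of $G=(V,E)$ has vertex set $E$, two vertices being adjacent if and only if the corresponding edges of $G$ share a vertex. Two letters $a\neq b$ alternate in a word $w$ if the subword of $w$ consisting of all occurrences of $a$ and $b$ is of the form $abab\cdots$ or $baba\cdots$ (of even or odd length). A word over $V$ is $k$-uniform if every letter of $V$ occurs in it exactly $k$ times. A word $w$ over $V$ (in which every vertex occurs) represents a graph $G=(V,E)$ if for all distinct $a,b\in V$: $\{a,b\}\in E$ if and only if $a$ and $b$ alternate in $w$; $G$ is word-representable if some word represents it. It is known that every word-representable graph is represented by a $k$-uniform word for some $k$; the representation number $\mathcal{R}(G)$ is the smallest such $k$. *)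

(* Defs.v *)
From mathcomp Require Import all_boot.
Set Implicit Arguments.
Unset Strict Implicit.
Unset Printing Implicit Defensive.

Record sgraph := SGraph {
  vertex :> finType;
  adj : rel vertex;
  adj_sym : symmetric adj;
  adj_irrefl : irreflexive adj }.

Definition edges (G : sgraph) : {set {set G}} :=
  [set A | [exists u : G, exists v : G, adj u v && (A == [set u; v])]].

Section LineGraph.
Variable G : sgraph.

Definition line_vertex : finType := {A : {set G} | A \in edges G}.

Definition line_adj : rel line_vertex :=
  [rel A B | (A != B) && (val A :&: val B != set0)].

Lemma line_adj_sym : symmetric line_adj.
Proof. by move=> A B; rewrite /line_adj /= eq_sym setIC. Qed.

Lemma line_adj_irrefl : irreflexive line_adj.
Proof. by move=> A; rewrite /line_adj /= eqxx. Qed.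

Definition line_graph : sgraph := SGraph line_adj_sym line_adj_irrefl.
End LineGraph.

(* A path starting at x is given by the sequence p of its vertices after x,  *)
(* so that its length (number of edges) is size p.                           *)
Definition path_edges (G : sgraph) (x : G) (p : seq G) : {set {set G}} :=
  [set:: pairmap (fun u v => [set u; v]) x p].

Record melon (G : sgraph) (m : nat) (x y : G) (P : 'I_m -> seq G) : Prop :=
  Melon {
    melon_gt0 : 0 < m;
    melon_ends : x != y;
    melon_path : forall i,
      [/\ path (@adj G) x (P i), last x (P i) = y & uniq (x :: P i)];
    melon_disjoint : forall i j, i != j ->
      forall v, v \in x :: P i -> v \in x :: P j -> v = x \/ v = y;
    melon_length1 : forall i j, size (P i) = 1 -> size (P j) = 1 -> i = j;
    melon_vertices : [set: G] = \bigcup_(i < m) [set:: x :: P i];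
    melon_edges : edges G = \bigcup_(i < m) path_edges x (P i) }.

(* The word a b a b ... of length n. *)
Definition alt_word (T : Type) (a b : T) (n : nat) : seq T :=
  mkseq (fun i => if odd i then b else a) n.

Definition alternate (T : eqType) (a b : T) (w : seq T) : Prop :=
  let s := [seq c <- w | (c == a) || (c == b)] in
  exists n, s = alt_word a b n \/ s = alt_word b a n.

Definition represents (G : sgraph) (w : seq G) : Prop :=
  (forall v : G, v \in w) /\
  (forall a b : G, a != b -> (adj a b <-> alternate a b w)).

Definition word_representable (G : sgraph) : Prop :=
  exists w : seq G, represents w.

Definition uniform (T : eqType) (k : nat) (w : seq T) : Prop :=
  forall v : T, count_mem v w = k.

Definition k_representable (G : sgraph) (k : nat) : Prop :=
  exists2 w : seq G, uniform k w & represents w.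

(* R(G) = k, as a relation: it has no value when G is not word-representable. *)
Definition is_representation_number (G : sgraph) (k : nat) : Prop :=
  k_representable G k /\ (forall j, k_representable G j -> k <= j).

(* Main.v *)
Require Import Defs.
From mathcomp Require Import all_boot zify.
From Stdlib Require Import Classical.
Set Implicit Arguments.
Unset Strict Implicit.
Unset Printing Implicit Defensive.

(** Write e_i and f_i for the first and the last edge of the i-th constituent
    path.  In the line graph the e_i form a clique, the f_i form a clique, and
    e_i is joined to f_i by an induced path through the edges between them;
    a constituent path of length one contributes a vertex z = e_i = f_i
    adjacent to both cliques ([melon_labelling]).  Call a constituent path long
    when it has at least two edges.

    Upper bounds come from three explicit words, written over labels (i, j)
    that stand for the j-th edge of the i-th path.  Their common ingredient is
    the word v_1 v_0 v_2 v_1 ... v_r v_(r-1) of a path ([weave]): consecutive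
    vertices cross in it, and a vertex occurring twice has between its two
    occurrences only neighbours on the same path, so that it alternates with
    nothing else.  With E and F the cliques listed in the order of the paths:
    - if there is no z, the 3-uniform word E . weaves . F . whole paths
      ([chordless_word_represents]);
    - if there is a z and at most two paths of length two, a 3-uniform word
      z . p . z . p' . z . p'' ([chord_word_represents]);
    - if there are at most two long paths, a 2-uniform word, read off from a
      circle of crossing chords, with z a diameter ([theta_word_represents]).
    Words for fewer paths are obtained by erasing letters.

    These cases are exhaustive: if a word represents a graph containing z, the
    number of occurrences of a neighbour of z in a prefix differs from that of
    z by at most one, and after normalization two neighbours of z are
    adjacent iff these counting functions are pointwise comparable
    ([alternating_level]).  So the neighbours of z induce a comparability
    graph, which three paths of length two, forming a triangular prism, rule
    out ([prism_not_comparability]).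

    For the lower bound, a 2-uniform word is a chord diagram in which adjacency
    is crossing.  The chords of e_1, e_2, e_3 of three long paths cut the
    circle into six arcs, arranged as a hexagon whose corners are the six ends.
    The rest of the i-th path meets no e_h except that its second edge meets
    e_i; following the path from e_i, all its chords stay in the two arcs next
    to one end of e_i ([near_start], [near_step]).  As f_1, f_2, f_3 cross
    pairwise, the three ends so obtained would be pairwise neighbouring corners
    of a hexagon ([near_not_all_cross]).  A 1-uniform word represents only
    complete graphs, and e_1, f_2 are not adjacent. *)

(** * Alternation *)

Section Alternation.
Variable T : eqType.
Implicit Types (a b c : T) (w s : seq T).

Definition differ : rel T := [rel c d | c != d].

(** Alternation says that no letter repeats in the two-letter subword; being a
    boolean that computes on explicit subwords, this form is the working one. *)
Definition alternating a b w :=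
  sorted differ [seq c <- w | (c == a) || (c == b)].

(** Alternation in which b does not come first, so that a does unless both
    letters are absent. *)
Definition leads a b w :=
  path differ b [seq c <- w | (c == a) || (c == b)].

Lemma alternating_sym a b w : alternating a b w = alternating b a w.
Proof. by rewrite /alternating; under eq_filter do rewrite orbC. Qed.

Lemma alt_wordS a b n : alt_word a b n.+1 = a :: alt_word b a n.
Proof.
rewrite /alt_word /mkseq /= -(addn0 1) iotaDl -map_comp; congr (_ :: _).
by apply: eq_map => i /=; case: (odd i).
Qed.

Lemma alt_word_path a b n : a != b -> path differ b (alt_word a b n).
Proof.
elim: n a b => [//|n IH] a b ab; rewrite alt_wordS /= /differ /= eq_sym ab.
by apply: IH; rewrite eq_sym.
Qed.

Lemma path_alt_word a b s :
  all (fun c => (c == a) || (c == b)) s -> path differ b s ->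
  s = alt_word a b (size s).
Proof.
elim: s a b => [//|c s IH] a b /= /andP[cab sab] /andP[bc cs].
have ca : c = a by case/orP: cab bc => /eqP-> //; rewrite /differ /= eqxx.
subst c; rewrite alt_wordS; congr (_ :: _).
by apply: IH => //; apply: sub_all sab => d; rewrite orbC.
Qed.

Lemma alternating_leads a b w : a != b ->
  alternating a b w = leads a b w || leads b a w.
Proof.
move=> ab; rewrite /alternating /leads.
under [in X in _ || X]eq_filter do rewrite orbC.
case E: [seq _ <- _ | _] => [//|c s] /=.
have: c \in [seq c <- w | (c == a) || (c == b)] by rewrite E mem_head.
rewrite mem_filter /differ /= => /andP[/orP[]/eqP-> _].
  by rewrite eqxx /= orbF eq_sym ab.
by rewrite eqxx ab.
Qed.

Lemma alternateP a b w : a != b -> alternate a b w <-> alternating a b w.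
Proof.
move=> ab; have ba : b != a by rewrite eq_sym.
rewrite /alternate /=; set s := filter _ _.
have -> : alternating a b w = path differ b s || path differ a s.
  rewrite (alternating_leads _ ab) /leads.
  by under [in X in _ || X]eq_filter do rewrite orbC.
split=> [[n [] ->]|H]; [by rewrite alt_word_path | by rewrite alt_word_path ?orbT |].
have sab : all (fun c => (c == a) || (c == b)) s by apply: filter_all.
exists (size s); case/orP: H => H; [left|right]; apply: path_alt_word => //.
by apply: sub_all sab => d; rewrite orbC.
Qed.

Definition occ a w n := count_mem a (take n w).

(** Counting occurrences in prefixes turns alternation into inequalities, which
    serve both lower-bound arguments. *)
Lemma leadsP a b w : a != b ->
  leads a b w <-> forall n, occ b w n <= occ a w n <= (occ b w n).+1.
Proof.
rewrite /occ; elim: w a b => [|c w IH] a b ab; first by [].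
have ba : b != a by rewrite eq_sym.
rewrite /leads /=; case: (eqVneq c a) => [->|ca] /=.
  rewrite /differ /= ba /=.
  have -> : path (fun c d => c != d) a [seq c <- w | (c == a) || (c == b)] = leads b a w.
    by rewrite /leads; under [in RHS]eq_filter do rewrite orbC.
  rewrite IH //; split=> H n.
    by case: n => [//|n] /=; rewrite eqxx (negPf ab); move: (H n); lia.
  by move: (H n.+1) => /=; rewrite eqxx (negPf ab); lia.
case: (eqVneq c b) => [->|cb] /=.
  rewrite /differ /= eqxx /=; split=> // /(_ 1) /=.
  by rewrite take0 eqxx (negPf ba).
rewrite -/(leads a b w) IH //; split=> H n.
  by case: n => [//|n] /=; rewrite (negPf ca) (negPf cb); apply: H.
by move: (H n.+1) => /=; rewrite (negPf ca) (negPf cb).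
Qed.

End Alternation.

(** * Labelled edges and words over labels *)

(** Adjacency in the line graph of a melon graph, for the label (i, j) of the
    j-th edge of the i-th path.  A path of length one has its only edge first
    and last at once. *)
Definition edge_adj (I : eqType) (len : I -> nat) (a b : I * nat) : bool :=
  if a.1 == b.1 then (a.2 == b.2.+1) || (b.2 == a.2.+1)
  else (a.2 == 0) && (b.2 == 0) || (a.2.+1 == len a.1) && (b.2.+1 == len b.1).

(** Letters that are not labels of paths below n are unconstrained, as they are
    erased when the word is carried to a graph. *)
Definition represents_labels (n : nat) (len : nat -> nat) (k : nat)
    (w : seq (nat * nat)) : Prop :=
  (forall a, a.1 < n -> a.2 < len a.1 -> count_mem a w = k) /\
  (forall a b, a.1 < n -> a.2 < len a.1 -> b.1 < n -> b.2 < len b.1 ->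
     a != b -> edge_adj len a b = alternating a b w).

Lemma edge_adj_sym (I : eqType) (len : I -> nat) (a b : I * nat) :
  edge_adj len a b = edge_adj len b a.
Proof.
rewrite /edge_adj eq_sym; case: ifP => _; first by rewrite orbC.
by congr (_ || _); rewrite andbC.
Qed.

Lemma represents_labelsP (n : nat) (len : nat -> nat) (k : nat) (w : seq (nat * nat)) :
  (forall i j, i < n -> j < len i -> count_mem (i, j) w = k) ->
  (forall i j l, i < n -> j < l < len i ->
     alternating (i, j) (i, l) w = (l == j.+1)) ->
  (forall i j h l, i < h < n -> j < len i -> l < len h ->
     alternating (i, j) (h, l) w =
       (j == 0) && (l == 0) || (j.+1 == len i) && (l.+1 == len h)) ->
  represents_labels n len k w.
Proof.
move=> Hc Hs Hd; split=> [[i j] /= *|]; first exact: Hc.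
move=> a b an al bn bl ab.
wlog: a b an al bn bl ab / (a.1 < b.1) || (a.1 == b.1) && (a.2 < b.2).
  move=> W; case H: ((a.1 < b.1) || (a.1 == b.1) && (a.2 < b.2)); first exact: W.
  rewrite edge_adj_sym alternating_sym; apply: W => //; first by rewrite eq_sym.
  move: H ab; rewrite -pair_eqE /pair_eq; move: (a.1) (a.2) (b.1) (b.2); lia.
case: a b an al bn bl {ab} => i j [h l] /= an al bn bl; rewrite /edge_adj /=.
case/orP=> [ih|/andP[/eqP ih jl]].
  by rewrite Hd ?ih //; case: eqP => //; lia.
subst h; rewrite eqxx Hs ?jl //; lia.
Qed.

Definition blocks (f : nat -> seq (nat * nat)) (s n : nat) :=
  flatten [seq f t | t <- iota s n].

Definition on_path (f : nat -> seq (nat * nat)) :=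
  forall t : nat, all (fun c : nat * nat => c.1 == t) (f t).

Lemma count_block (f : nat -> seq (nat * nat)) (t : nat) (a : nat * nat) :
  on_path f -> a.1 != t -> count_mem a (f t) = 0.
Proof.
move=> /(_ t) ft at_; apply/count_memPn; apply/negP => /(allP ft) /eqP at'.
by rewrite at' eqxx in at_.
Qed.

(** A block mentions a single path, so at least one of the two counts is zero. *)
Lemma filter_block (f : nat -> seq (nat * nat)) (t i j h l : nat) :
  on_path f -> i < h ->
  [seq c <- f t | (c == (i, j)) || (c == (h, l))] =
  nseq (count_mem (i, j) (f t)) (i, j) ++ nseq (count_mem (h, l) (f t)) (h, l).
Proof.
move=> /(_ t); elim: (f t) => [//|[u v] q IH] /= /andP[/eqP ut qt] ih.
rewrite IH //; case: eqP => [[ui vj]|_] /=.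
  have -> : ((u, v) == (h, l)) = false by rewrite -pair_eqE /pair_eq /=; lia.
  by rewrite -ui -vj.
case: eqP => [[uh vl]|_] //=.
have -> : count_mem (i, j) q = 0.
  apply/count_memPn; apply/negP => /(allP qt) /=; lia.
by rewrite -uh -vl.
Qed.

Lemma count_blocks (f : nat -> seq (nat * nat)) (s n i j : nat) : on_path f ->
  count_mem (i, j) (blocks f s n) =
  if s <= i < s + n then count_mem (i, j) (f i) else 0.
Proof.
move=> Hf; rewrite /blocks; elim: n s => [|n IH] s /=; first by case: ifP => //; lia.
rewrite count_cat IH; case: (eqVneq i s) => [->|ne].
  by have -> : s.+1 <= s < s.+1 + n = false; [lia|]; case: ifP; lia.
rewrite (@count_block f s (i, j)) //; case: ifP => A; case: ifP => B //; lia.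
Qed.

Lemma filter_blocks_same (f : nat -> seq (nat * nat)) (s n i j l : nat) : on_path f ->
  [seq c <- blocks f s n | (c == (i, j)) || (c == (i, l))] =
  if s <= i < s + n then [seq c <- f i | (c == (i, j)) || (c == (i, l))] else [::].
Proof.
move=> Hf; rewrite /blocks; elim: n s => [|n IH] s /=; first by case: ifP => //; lia.
rewrite filter_cat IH; case: (eqVneq i s) => [->|ne].
  have -> : s.+1 <= s < s.+1 + n = false by lia.
  by rewrite cats0; case: ifP => //; lia.
have -> : [seq c <- f s | (c == (i, j)) || (c == (i, l))] = [::].
  apply/eqP; rewrite -(negbK (_ == _)) -has_filter.
  apply/hasPn => -[u v] /(allP (Hf s)) /= /eqP us.
  by rewrite -!pair_eqE /pair_eq /=; lia.
by congr (if _ then _ else _); lia.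
Qed.

Lemma filter_blocks_diff (f : nat -> seq (nat * nat)) (s n i j h l : nat) :
  on_path f -> i < h ->
  [seq c <- blocks f s n | (c == (i, j)) || (c == (h, l))] =
  nseq (if s <= i < s + n then count_mem (i, j) (f i) else 0) (i, j) ++
  nseq (if s <= h < s + n then count_mem (h, l) (f h) else 0) (h, l).
Proof.
move=> Hf ih; rewrite -!count_blocks // /blocks; elim: n s => [//|n IH] s /=.
rewrite filter_cat IH filter_block // !count_cat.
case: (ltnP s h) => sh.
  by rewrite (@count_block f s (h, l)) //= ?cats0 ?catA -?nseqD // neq_ltn sh orbT.
rewrite !(@count_blocks f _ _ i) // ifF ?addn0; last lia.
by rewrite /= -!catA -nseqD.
Qed.

Definition start_block t : seq (nat * nat) := [:: (t, 0)].
Definition end_block (len : nat -> nat) t : seq (nat * nat) := [:: (t, (len t).-1)].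
Definition run_block (len : nat -> nat) t := [seq (t, j) | j <- iota 0 (len t)].

(** The word v_1 v_0 v_2 v_1 ... v_r v_(r-1) of the path v_0 ... v_r: inner
    vertices occur twice, the two ends once.  For r = 1 it is v_1 v_0. *)
Fixpoint weave (t r : nat) : seq (nat * nat) :=
  if r is q.+1 then weave t q ++ [:: (t, q.+1); (t, q)] else [::].
Definition weave_block (len : nat -> nat) t := weave t (len t).-1.

Lemma weave_path (r t : nat) : all (fun c => c.1 == t) (weave t r).
Proof. by elim: r => //= r IH; rewrite all_cat IH /= eqxx. Qed.

Lemma run_path (s : seq nat) (t : nat) : all (fun c => c.1 == t) [seq (t, j) | j <- s].
Proof. by rewrite all_map; apply/allP => j _ /=. Qed.

Lemma count_weave (t r j : nat) : count_mem (t, j) (weave t r) = (0 < j <= r) + (j < r).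
Proof.
elim: r => [|r IH] /=; first by lia.
rewrite count_cat IH /= -!pair_eqE /pair_eq /= eqxx /=; lia.
Qed.

(** The occurrences of v_j precede those of v_l: vertices at distance at least
    two do not interleave. *)
Lemma filter_weave_far (t r j l : nat) : j.+1 < l ->
  [seq c <- weave t r | (c == (t, j)) || (c == (t, l))] =
  nseq ((0 < j <= r) + (j < r)) (t, j) ++ nseq ((l <= r) + (l < r)) (t, l).
Proof.
move=> jl; elim: r => [|r IH] /=.
  rewrite (_ : (0 < j <= 0) + (j < 0) = 0); last lia.
  by rewrite (_ : (l <= 0) + (l < 0) = 0); last lia.
rewrite filter_cat IH /= -!pair_eqE /pair_eq /= !eqxx /= {IH}.
have [rl|rl] : r.+1 < l \/ l <= r.+1 by lia.
  have -> : (l <= r) + (l < r) = 0 by lia.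
  have -> : (l <= r.+1) + (l < r.+1) = 0 by lia.
  have -> : (0 < j <= r.+1) + (j < r.+1) = ((0 < j <= r) + (j < r)) + ((r.+1 == j) + (r == j)) by lia.
  have [-> ->] : (r.+1 == l) = false /\ (r == l) = false by lia.
  rewrite [in RHS]nseqD /= !cats0 !orbF; congr (_ ++ _).
  by case: eqP => [<-|_]; case: eqP => [<-|_].
have [-> ->] : (r.+1 == j) = false /\ (r == j) = false by lia.
have -> : (0 < j <= r.+1) + (j < r.+1) = (0 < j <= r) + (j < r) by lia.
have -> : (l <= r.+1) + (l < r.+1) = ((l <= r) + (l < r)) + ((r.+1 == l) + (r == l)) by lia.
rewrite [nseq (_ + (_ + _)) (t, l)]nseqD -catA; do 2!congr (_ ++ _).
by rewrite /=; case: eqP => [<-|_]; case: eqP => [<-|_].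
Qed.

(** Consecutive vertices occur as v_j v_(j+1) v_j v_(j+1), up to the missing
    occurrences at the ends of the path. *)
Lemma filter_weave_near (t r j : nat) :
  [seq c <- weave t r | (c == (t, j)) || (c == (t, j.+1))] =
  nseq (0 < j <= r) (t, j) ++
  (if j < r then [:: (t, j.+1); (t, j)] else [::]) ++ nseq (j.+1 < r) (t, j.+1).
Proof.
elim: r => [|r IH] /=; first by rewrite leqn0 andbC; case: j.
rewrite filter_cat IH /= -!pair_eqE /pair_eq /= !eqxx /= {IH} eqSS.
have [rj|[rj|rj]] : r < j \/ j < r \/ r = j by lia.
- rewrite (_ : j < r.+1 = false); last lia.
  rewrite (_ : j.+1 < r = false); last lia.
  rewrite (_ : j.+1 < r.+1 = false); last lia.
  rewrite (_ : 0 < j <= r = false); last lia.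
  rewrite (_ : r == j.+1 = false); last lia.
  rewrite (_ : j < r = false); last lia.
  have -> : (r == j) = false by lia.
  rewrite !orbF /=.
  case: (eqVneq r.+1 j) => [<-|ne] /=; first by rewrite ltnSn.
  by rewrite (_ : 0 < j <= r.+1 = false) //; lia.
- rewrite (_ : 0 < j <= r.+1 = (0 < j <= r)); last lia.
  have [-> ->] : (r.+1 == j) = false /\ (r == j) = false by lia.
  have [-> ->] : j < r.+1 /\ j.+1 < r.+1 by lia.
  rewrite rj -catA /=; congr (_ ++ _); congr [:: _, _ & _].
  have [->|ne] := eqVneq r j.+1; first by rewrite ltnn.
  by have -> : j.+1 < r by lia.
- subst r; rewrite (_ : (j == j.+1) = false); last lia.
  rewrite (_ : (j.+1 < j) = false); last lia.
  rewrite (_ : (0 < j <= j.+1) = (0 < j <= j)); last lia.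
  by rewrite ltnSn !ltnn eqxx orbT /= cats0.
Qed.

Lemma start_on_path : on_path start_block.
Proof. by move=> t /=; rewrite eqxx. Qed.
Lemma end_on_path len : on_path (end_block len).
Proof. by move=> t /=; rewrite eqxx. Qed.
Lemma weave_on_path len : on_path (weave_block len).
Proof. by move=> t; apply: weave_path. Qed.
Lemma run_on_path len : on_path (run_block len).
Proof. by move=> t; apply: run_path. Qed.
#[local] Hint Resolve start_on_path end_on_path weave_on_path run_on_path : core.

Section BlockCounts.
Variables (len : nat -> nat) (t i j : nat).

Lemma count_start : count_mem (i, j) (start_block t) = (i == t) && (j == 0).
Proof. by rewrite /= -pair_eqE /pair_eq /= addn0 eq_sym [0 == _]eq_sym. Qed.

Hypothesis j_len : j < len i.

Lemma count_end :
  count_mem (i, j) (end_block len t) = (i == t) && (j.+1 == len i).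
Proof.
rewrite /= -pair_eqE /pair_eq /=.
by have [->|ti] := eqVneq t i; lia.
Qed.

Lemma count_weave_block :
  count_mem (i, j) (weave_block len t) =
  if i == t then (j != 0) + (j.+1 != len i) else 0.
Proof.
have [<-|it] := eqVneq i t; first by rewrite count_weave; lia.
by apply: count_block.
Qed.

Lemma count_run : count_mem (i, j) (run_block len i) = 1.
Proof.
rewrite count_uniq_mem; last by rewrite map_inj_uniq ?iota_uniq // => u v [].
by rewrite map_f // mem_iota.
Qed.
End BlockCounts.

Lemma filter_iota (s n j l : nat) : j < l ->
  [seq c <- iota s n | (c == j) || (c == l)] =
  nseq (s <= j < s + n) j ++ nseq (s <= l < s + n) l.
Proof.
move=> jl; elim: n s => [|n IH] s /=.
  by rewrite addn0 !(leqNgt s) !andNb.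
rewrite IH !addSnnS; have [->|sj] := eqVneq s j.
  have -> : (j < j < j + n.+1) = false by lia.
  have -> : (j <= j < j + n.+1) = true by lia.
  by have -> : (j <= l < j + n.+1) = (j < l < j + n.+1) by lia.
have -> : (s < j < s + n.+1) = (s <= j < s + n.+1) by lia.
have [->|sl] /= := eqVneq s l; last by congr (_ ++ nseq _ _); lia.
have -> : (l <= j < l + n.+1) = false by lia.
have -> : (l < l < l + n.+1) = false by lia.
by have -> : (l <= l < l + n.+1) = true by lia.
Qed.

Lemma filter_run (t s n j l : nat) : j < l ->
  [seq c <- [seq (t, i) | i <- iota s n] | (c == (t, j)) || (c == (t, l))] =
  nseq (s <= j < s + n) (t, j) ++ nseq (s <= l < s + n) (t, l).
Proof.
move=> jl; rewrite filter_map -(map_nseq _ (pair t) j) -(map_nseq _ (pair t) l).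
rewrite -map_cat -filter_iota //.
congr map; apply: eq_filter => c.
by rewrite /= -!pair_eqE /pair_eq /= !eqxx.
Qed.

Lemma filter_start (i j l : nat) : j < l ->
  [seq c <- start_block i | (c == (i, j)) || (c == (i, l))] = nseq (j == 0) (i, j).
Proof.
case: l => // l _; rewrite /= -!pair_eqE /pair_eq /= !eqxx orbF eq_sym.
by case: eqP => [->|].
Qed.

Section FilterSamePath.
Variables (len : nat -> nat) (i j l : nat).
Hypothesis jl : j < l < len i.

Lemma filter_end :
  [seq c <- end_block len i | (c == (i, j)) || (c == (i, l))] = nseq (l.+1 == len i) (i, l).
Proof.
rewrite /= -!pair_eqE /pair_eq /= !eqxx /= (_ : (_ == j) = false) /=; last lia.
have [e|ne] := eqVneq (len i).-1 l; first by rewrite (_ : l.+1 == len i) ?e //; lia.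
by rewrite (_ : (l.+1 == len i) = false) //; lia.
Qed.

Lemma filter_run_block :
  [seq c <- run_block len i | (c == (i, j)) || (c == (i, l))] = [:: (i, j); (i, l)].
Proof.
case/andP: jl => jl' ll.
by rewrite filter_run //= add0n (ltn_trans jl' ll) ll.
Qed.

Lemma filter_weave_block :
  [seq c <- weave_block len i | (c == (i, j)) || (c == (i, l))] =
  nseq (j != 0) (i, j) ++
  (if l == j.+1 then [:: (i, l); (i, j)] else [:: (i, j); (i, l)]) ++
  nseq (l.+1 != len i) (i, l).
Proof.
case/andP: jl => jl' ll; rewrite /weave_block.
have [->|lj] := eqVneq l j.+1.
  rewrite filter_weave_near (_ : j < (len i).-1); last lia.
  by congr (nseq _ _ ++ _ ++ nseq _ _); lia.
rewrite filter_weave_far; last lia.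
have -> : (0 < j <= (len i).-1) + (j < (len i).-1) = (j != 0) + 1 by lia.
have -> : (l <= (len i).-1) + (l < (len i).-1) = 1 + (l.+1 != len i) by lia.
by rewrite !nseqD -!catA.
Qed.
End FilterSamePath.

Lemma filter_off (f : nat -> seq (nat * nat)) (t i j l : nat) : on_path f -> t != i ->
  [seq c <- f t | (c == (i, j)) || (c == (i, l))] = [::].
Proof.
move=> /(_ t) /allP ft ti; apply/eqP; rewrite -(negbK (_ == _)) -has_filter.
apply/hasPn => -[u v] /ft /= /eqP ->; rewrite -!pair_eqE /pair_eq /=; lia.
Qed.

(** The last vertex of a path, then its inner vertices in order. *)
Definition tail_block (len : nat -> nat) t :=
  end_block len t ++ [seq (t, j) | j <- iota 1 (len t - 2)].

Lemma tail_on_path len : on_path (tail_block len).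
Proof. by move=> t; rewrite all_cat end_on_path run_path. Qed.
#[local] Hint Resolve tail_on_path : core.

Lemma count_tail (len : nat -> nat) (t i j : nat) : j < len i ->
  count_mem (i, j) (tail_block len t) =
  if i == t then (j.+1 == len i) + ((j != 0) && (j.+1 != len i)) else 0.
Proof.
case: (eqVneq i t) => [<-|it] jl; last exact: count_block.
rewrite count_cat count_end // eqxx andTb; congr (_ + _); rewrite count_uniq_mem.
  case: (boolP (j \in iota 1 (len i - 2))) => H.
    by rewrite map_f // -[LHS]/1; move: H; rewrite mem_iota; lia.
  rewrite (_ : _ \in _ = false); last by apply: contraNF H => /mapP[u ? [->]].
  by move: H; rewrite mem_iota; lia.
by rewrite map_inj_uniq ?iota_uniq // => u v [].
Qed.

Lemma filter_tail (len : nat -> nat) (i j l : nat) : j < l < len i ->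
  [seq c <- tail_block len i | (c == (i, j)) || (c == (i, l))] =
  nseq (l.+1 == len i) (i, l) ++ nseq (j != 0) (i, j) ++ nseq (l.+1 != len i) (i, l).
Proof.
move=> jl; have jl' : j < l by case/andP: jl.
rewrite filter_cat filter_end // filter_run //.
by congr (_ ++ (nseq _ _ ++ nseq _ _)); lia.
Qed.

(** Once the subword is a concatenation of powers of two letters whose exponents
    depend only on which of j, l are first or last on their paths, the sixteen
    cases are decided by computation. *)
Ltac compute_alternation len i j h l :=
  have [|y_i] := eqVneq j 0; have [|y_h] := eqVneq l 0;
  have [|z_i] := eqVneq j.+1 (len i); have [|z_h] := eqVneq l.+1 (len h);
  let ab := fresh "ab" in
  (have ab : (i, j) != (h, l) by rewrite -pair_eqE /pair_eq /=; lia);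
  let ba := fresh "ba" in
  (have ba : (h, l) != (i, j) by rewrite eq_sym);
  let a := fresh "a" in let b := fresh "b" in
  move: ab ba; generalize (i, j) (h, l) => a b ab ba;
  rewrite /= /differ /= ?eqxx ?ab ?ba //=; lia.

(** * Three words *)

(** The first edges, then all weaves, then the last edges, then all paths in
    full.  An e_j and an f_i with j < i fail to alternate because e_j occurs
    twice before f_i; with i < j, because the weave of i and the list of last
    edges put two f_i between the weave of j and its next e_j.  On one path
    e_i and f_i alternate only if the weave has f_i before e_i, which happens
    exactly when the path has two edges. *)
Definition chordless_word (n : nat) (len : nat -> nat) :=
  blocks start_block 0 n ++ blocks (weave_block len) 0 n ++
  blocks (end_block len) 0 n ++ blocks (run_block len) 0 n.

Lemma chordless_word_represents n len : (forall i, i < n -> 1 < len i) ->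
  represents_labels n len 3 (chordless_word n len).
Proof.
move=> len2; apply: represents_labelsP
  => [i j i_n jl|i j l i_n /andP[jl ll]|i j h l /andP[ih hn] jl ll].
- rewrite /chordless_word !count_cat !count_blocks // add0n i_n leq0n.
  by rewrite count_start count_end // count_weave_block // count_run // ?eqxx /=; lia.
- have jll : j < l < len i by rewrite jl.
  have len_i := len2 _ i_n.
  rewrite /alternating /chordless_word !filter_cat !filter_blocks_same //.
  rewrite add0n i_n leq0n.
  rewrite filter_start // filter_weave_block // filter_end // filter_run_block //=.
  by have [|lj] := eqVneq l j.+1; compute_alternation len i j i l.
- have i_n : i < n by lia.
  have len_i := len2 _ i_n; have len_h := len2 _ hn.
  rewrite /alternating /chordless_word !filter_cat !filter_blocks_diff //.
  rewrite !add0n i_n hn !count_start !count_end // !count_weave_block //.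
  rewrite !count_run // ?eqxx.
  by compute_alternation len i j h l.
Qed.

(** Path 0 is the chord z.  The diameter z of a circle separates the weaves of
    paths 1 and 2, running in opposite directions; each first or last edge has
    its second occurrence on the other side of z, crossing z and the
    corresponding edge of the other path. *)
Definition theta_word (len : nat -> nat) :=
  start_block 0 ++ start_block 2 ++ weave_block len 1 ++ end_block len 2 ++
  start_block 0 ++ end_block len 1 ++ rev (weave_block len 2) ++ start_block 1.

Lemma theta_word_represents len : len 0 = 1 -> 1 < len 1 -> 1 < len 2 ->
  represents_labels 3 len 2 (theta_word len).
Proof.
move=> len0 len1 len2; apply: represents_labelsP
  => [i j i_n jl|i j l i_n /andP[jl ll]|i j h l /andP[ih hn] jl ll].
- rewrite !count_cat count_rev !count_start !count_end ?count_weave_block; try lia.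
  move: i_n jl; case: i => [|[|[|//]]] _ jl /=; lia.
- have jll : j < l < len i by rewrite jl.
  have i_pos : i = 1 \/ i = 2 by move: i_n ll jl; case: (i) => [|[|[|//]]]; rewrite ?len0; lia.
  rewrite /alternating !filter_cat filter_rev; case: i_pos => i_eq; subst i.
    rewrite !(@filter_off start_block 0) // !(@filter_off start_block 2) //.
    rewrite !(@filter_off (end_block len) 2) // !(@filter_off (weave_block len) 2) //.
    rewrite filter_weave_block // filter_end // filter_start //.
    by have [|lj] := eqVneq l j.+1; compute_alternation len 1 j 1 l.
  rewrite !(@filter_off start_block 0) // !(@filter_off start_block 1) //.
  rewrite !(@filter_off (end_block len) 1) // !(@filter_off (weave_block len) 1) //.
  rewrite filter_weave_block // filter_end // filter_start //.
  by have [|lj] := eqVneq l j.+1; compute_alternation len 2 j 2 l.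
- rewrite /alternating !filter_cat filter_rev !(@filter_block start_block) //.
  rewrite !(@filter_block (end_block len)) // !(@filter_block (weave_block len)) //.
  rewrite !count_start !count_end // !count_weave_block //.
  move: ih hn jl ll; case: i => [|[|[|i]]]; case: h => [|[|[|h]]] // _ _ jl ll.
  + by compute_alternation len 0 j 1 l.
  + by compute_alternation len 0 j 2 l.
  + by compute_alternation len 1 j 2 l.
Qed.

(** Path 0 is z, paths 1 and 2 have length two, and the others have length at
    least three.  After each occurrence of z all e_i and f_i occur once before
    the next, so they alternate with z and with one another exactly when their order
    is the same in the three factors.  The e_i come in the order 1, 3, 4, ..., 2
    and the f_i in the order 2, 3, 4, ..., 1.  The first factor puts the e_i
    before the f_i except for path 2, the second one the f_i before the e_i
    except for path 1; hence only the pairs of paths 1 and 2 keep their order.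
    An inner edge of another path alternates with no letter outside its path
    because of its two occurrences in the weave; its remaining occurrence, at
    the end of the first factor, falls between the two occurrences of f_i and
    of e_i outside the weave. *)
Definition chord_word (n : nat) (len : nat -> nat) :=
  start_block 0 ++
  start_block 1 ++ blocks start_block 3 n ++ end_block len 2 ++ start_block 2 ++
    blocks (tail_block len) 3 n ++ end_block len 1 ++
  start_block 0 ++
  end_block len 2 ++ blocks (end_block len) 3 n ++ start_block 1 ++
    end_block len 1 ++ blocks start_block 3 n ++ start_block 2 ++
  start_block 0 ++
  start_block 1 ++ end_block len 2 ++ blocks (weave_block len) 3 n ++
    start_block 2 ++ end_block len 1.

Lemma chord_word_represents n len : len 0 = 1 -> len 1 = 2 -> len 2 = 2 ->
  (forall i, 2 < i -> 2 < len i) ->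
  represents_labels (3 + n) len 3 (chord_word n len).
Proof.
move=> len0 len1 len2 len3; apply: represents_labelsP
  => [i j i_n jl|i j l i_n /andP[jl ll]|i j h l /andP[ih hn] jl ll].
- rewrite !count_cat !count_blocks // !count_start !count_end //.
  rewrite count_weave_block // count_tail //.
  move: i_n jl; case: i => [|[|[|i]]] i_n jl /=; try lia.
  by rewrite i_n !eqxx /=; have := len3 i.+3 isT; lia.
- have jll : j < l < len i by rewrite jl.
  rewrite /alternating !filter_cat !filter_blocks_same //.
  have i_pos : [\/ i = 1, i = 2 | 2 < i].
    move: i_n ll jl; case: (i) => [|[|[|u]]] *; by [lia|constructor 1|constructor 2|constructor 3].
  case: i_pos => i_pos.
  + subst i; rewrite !(@filter_off start_block 0) // !(@filter_off start_block 2) //.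
    rewrite !(@filter_off (end_block len) 2) // filter_start // filter_end //=.
    by compute_alternation len 1 j 1 l.
  + subst i; rewrite !(@filter_off start_block 0) // !(@filter_off start_block 1) //.
    rewrite !(@filter_off (end_block len) 1) // filter_start // filter_end //=.
    by compute_alternation len 2 j 2 l.
  + have len_i := len3 i i_pos; rewrite i_pos i_n.
    rewrite !(@filter_off start_block 0) ?(@filter_off start_block 1)
       ?(@filter_off start_block 2) ?(@filter_off (end_block len) 1)
       ?(@filter_off (end_block len) 2) //; try lia.
    rewrite filter_start // filter_end // filter_weave_block // filter_tail //.
    have [|lj] := eqVneq l j.+1; compute_alternation len i j i l.
- rewrite /alternating !filter_cat !filter_blocks_diff //.
  rewrite !(@filter_block start_block) // !(@filter_block (end_block len)) //.
  rewrite !count_start !count_end // !count_weave_block // !count_tail //.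
  move: ih hn jl ll; case: i => [|[|[|i]]]; case: h => [|[|[|h]]] // ih hn jl ll.
  + by compute_alternation len 0 j 1 l.
  + by compute_alternation len 0 j 2 l.
  + have len_h := len3 h.+3 isT; rewrite hn !eqxx.
    by compute_alternation len 0 j h.+3 l.
  + by compute_alternation len 1 j 2 l.
  + have len_h := len3 h.+3 isT; rewrite hn !eqxx.
    by compute_alternation len 1 j h.+3 l.
  + have len_h := len3 h.+3 isT; rewrite hn !eqxx.
    by compute_alternation len 2 j h.+3 l.
  + have len_h := len3 h.+3 isT; have len_i := len3 i.+3 isT.
    rewrite hn (ltn_trans ih hn) /= !eqxx.
    by compute_alternation len i.+3 j h.+3 l.
Qed.

(** * Transfer to line graphs of melon graphs *)

Lemma alternating_map (T U : eqType) (f : T -> U) (a b : T) (w : seq T) :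
  injective f -> alternating (f a) (f b) (map f w) = alternating a b w.
Proof.
move=> f_inj; rewrite /alternating filter_map sorted_map.
under eq_filter do rewrite /= !(inj_eq f_inj).
by apply: eq_sorted => c d; rewrite /= /differ /= (inj_eq f_inj).
Qed.

Lemma alternating_filter (T : eqType) (p : pred T) (a b : T) (w : seq T) :
  p a -> p b -> alternating a b (filter p w) = alternating a b w.
Proof.
move=> pa pb; rewrite /alternating -filter_predI; congr sorted.
by apply: eq_filter => c /=; case: eqP => [->|_]; [rewrite pa | case: eqP => [->|]].
Qed.

Lemma representsP (G : sgraph) (w : seq G) :
  represents w <-> (forall v, v \in w) /\
    (forall a b : G, a != b -> adj a b = alternating a b w).
Proof.
split=> -[w_all H]; split=> // a b ab; last by rewrite H //; split=> /(alternateP _ ab).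
by apply/idP/idP => [/(H a b ab)/(alternateP _ ab)|/(alternateP _ ab)/(H a b ab)].
Qed.

Section Transfer.
Variables (G : sgraph) (n : nat) (len : nat -> nat) (k : nat).
Variables (w : seq (nat * nat)) (lab : G -> nat * nat).
Hypothesis lab_inj : injective lab.
Hypothesis lab_valid : forall v, (lab v).1 < n /\ (lab v).2 < len (lab v).1.
Hypothesis lab_adj : forall u v, u != v -> adj u v = edge_adj len (lab u) (lab v).

(** Only the labels taken by the vertices of the graph are kept: erasing other
    letters does not affect alternation, so a word for a family of paths serves
    every subfamily. *)
Lemma k_representable_labels :
  0 < k -> represents_labels n len k w -> k_representable G k.
Proof.
move=> k_gt0 [w_count w_adj].
pose unlab p := [pick v | lab v == p].
have labK : ocancel unlab lab by move=> p; rewrite /unlab; case: pickP => //= v /eqP.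
have lab_some v : unlab (lab v).
  by rewrite /unlab; case: pickP => // /(_ v); rewrite eqxx.
have mapE := pmap_filter labK w.
have uni : uniform k (pmap unlab w).
  move=> v; have [vn vl] := lab_valid v; rewrite -(w_count _ vn vl).
  transitivity (count_mem (lab v) (map lab (pmap unlab w))).
    by rewrite count_map; apply: eq_count => u; rewrite /= (inj_eq lab_inj).
  rewrite mapE count_filter; apply: eq_count => p /=.
  by case: eqP => [->|//]; rewrite lab_some.
exists (pmap unlab w) => //; apply/representsP; split=> [v|u v uv].
  by rewrite -has_pred1 has_count uni.
have [un ul] := lab_valid u; have [vn vl] := lab_valid v.
rewrite lab_adj // w_adj // ?(inj_eq lab_inj) // -(alternating_map _ _ _ lab_inj) mapE.
by rewrite alternating_filter.
Qed.
End Transfer.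

Section MelonLabels.
Variables (M : sgraph) (m : nat) (x y : M) (P : 'I_m -> seq M).
Hypothesis hM : melon x y P.

Let vtx (i : 'I_m) (j : nat) : M := nth x (x :: P i) j.
Let step (i : 'I_m) (j : nat) : {set M} := [set vtx i j; vtx i j.+1].

Lemma vtx_inj i j l : j <= size (P i) -> l <= size (P i) -> vtx i j = vtx i l -> j = l.
Proof.
have [_ _ u] := melon_path hM i.
by move=> ji li /eqP; rewrite nth_uniq // => /eqP.
Qed.

Lemma vtx_mem i j : j <= size (P i) -> vtx i j \in x :: P i.
Proof. by move=> ji; apply: mem_nth. Qed.

Lemma vtx_last i : vtx i (size (P i)) = y.
Proof. by have [_ <- _] := melon_path hM i; rewrite /vtx -nth_last /=; case: (P i). Qed.

(** Two constituent paths meet only in x and y, and each passes through x only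
    at its start and through y only at its end. *)
Lemma vtx_eq i j h l : j <= size (P i) -> l <= size (P h) -> i != h ->
  vtx i j = vtx h l -> (j = 0 /\ l = 0) \/ (j = size (P i) /\ l = size (P h)).
Proof.
move=> ji lh ih e.
have jm := vtx_mem ji; have lm := vtx_mem lh; rewrite -e in lm.
case: (melon_disjoint hM ih jm lm) => v_end; [left|right]; split.
- by apply: (vtx_inj (i := i)).
- by apply: (vtx_inj (i := h)) => //; rewrite -e.
- by apply: (vtx_inj (i := i)) => //; rewrite vtx_last.
- by apply: (vtx_inj (i := h)) => //; rewrite vtx_last -e.
Qed.

Lemma mem_path_edges i A :
  reflect (exists2 j, j < size (P i) & A = step i j) (A \in path_edges x (P i)).
Proof.
rewrite inE; apply: (iffP (nthP set0)).
  rewrite size_pairmap => -[j ji <-]; exists j => //.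
  by rewrite (nth_pairmap x).
move=> [j ji ->]; exists j; rewrite ?size_pairmap //.
by rewrite (nth_pairmap x).
Qed.

Lemma step_edge i j : j < size (P i) -> step i j \in edges M.
Proof.
move=> ji; rewrite (melon_edges hM); apply/bigcupP; exists i => //.
by apply/mem_path_edges; exists j.
Qed.

Lemma steps_meet i j h l : j < size (P i) -> l < size (P h) -> (i, j) != (h, l) ->
  (step i j :&: step h l != set0) = edge_adj (fun i => size (P i)) (i, j) (h, l).
Proof.
move=> ji lh ne; rewrite /edge_adj /=; apply/set0Pn/idP => [[v]|].
  rewrite !inE => /andP[v1 v2].
  have [j' [l' [j'E l'E e]]] : exists j' l',
      [/\ j' = j \/ j' = j.+1, l' = l \/ l' = l.+1 & vtx i j' = vtx h l'].
    move: v1 v2 => /orP[]/eqP-> /orP[]/eqP e;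
      [exists j, l|exists j, l.+1|exists j.+1, l|exists j.+1, l.+1]; split; auto.
  have [ih|ih] := eqVneq i h.
    subst h; have := @vtx_inj i j' l'; rewrite e => /(_ _ _ erefl) E.
    have {}E : j' = l' by apply: E; lia.
    by move/eqP: ne => ne; have : j != l by [apply/eqP => jl; apply: ne; rewrite jl]; lia.
  by case: (@vtx_eq i j' h l') => //; lia.
have [ih|ih] /= := eqVneq i h.
  subst h; move=> /orP[]/eqP E; [exists (vtx i j)|exists (vtx i l)].
    by rewrite !inE E eqxx orbT.
  by rewrite !inE E eqxx orbT.
case/orP=> /andP[/eqP jE /eqP lE].
  by exists x; rewrite jE lE !inE /= eqxx.
by exists y; rewrite !inE jE lE !vtx_last !eqxx !orbT.
Qed.

(** Edges of distinct paths differ because two paths of length one are equal. *)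
Lemma step_inj i j h l : j < size (P i) -> l < size (P h) ->
  step i j = step h l -> (i, j) = (h, l).
Proof.
move=> ji lh e.
have /set2P v1 : vtx i j \in step h l by rewrite -e set21.
have /set2P v2 : vtx i j.+1 \in step h l by rewrite -e set22.
have [ih|ih] := eqVneq i h.
  subst h; congr (_, _).
  have {v1} : j = l \/ j = l.+1 by case: v1 => /vtx_inj E; [left|right]; apply: E; lia.
  have {v2} : j.+1 = l \/ j.+1 = l.+1 by case: v2 => /vtx_inj E; [left|right]; apply: E; lia.
  lia.
have {v1} H1 : (j = 0 /\ (l = 0 \/ l.+1 = 0)) \/ (j = size (P i)).
  by case: v1 => /vtx_eq E; case: E => //; lia.
have {v2} H2 : (j.+1 = 0) \/ (j.+1 = size (P i) /\ (l = size (P h) \/ l.+1 = size (P h))).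
  by case: v2 => /vtx_eq E; case: E => //; lia.
by case/eqP: ih; apply: (melon_length1 hM); lia.
Qed.

Lemma melon_labelling : exists lab : line_graph M -> 'I_m * nat,
  [/\ injective lab,
      forall A, (lab A).2 < size (P (lab A).1),
      forall p, p.2 < size (P p.1) -> exists A, lab A = p &
      forall A B, A != B ->
        adj A B = edge_adj (fun i => size (P i)) (lab A) (lab B)].
Proof.
have lab_ex (A : line_graph M) : exists p : 'I_m * nat, (p.2 < size (P p.1)) && (val A == step p.1 p.2).
  have edge_cover S : S \in edges M -> S \in \bigcup_(i < m) path_edges x (P i).
    by rewrite (melon_edges hM).
  have /edge_cover/bigcupP := valP A => -[i _ /mem_path_edges[j ji e]].
  by exists (i, j); rewrite ji -e eqxx.
pose lab A := xchoose (lab_ex A).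
have labP A : (lab A).2 < size (P (lab A).1) /\ val A = step (lab A).1 (lab A).2.
  by have /andP[? /eqP ?] := xchooseP (lab_ex A).
have lab_inj : injective lab.
  by move=> A B e; apply: val_inj; rewrite (labP A).2 (labP B).2 e.
exists lab; split=> // [A|[i j] /= ji|A B AB]; first exact: (labP A).1.
  exists (Sub (step i j) (step_edge ji)).
  set A := Sub _ _; have [Al Ae] := labP A.
  by rewrite [lab A]surjective_pairing; apply: step_inj => //; rewrite -Ae.
have [Al Ae] := labP A; have [Bl Be] := labP B.
rewrite /= /line_adj /= AB Ae Be steps_meet -?surjective_pairing //.
by rewrite (inj_eq lab_inj).
Qed.
End MelonLabels.

(** * Neighbourhoods as comparability graphs *)

Section Apex.
Variables (T : eqType) (w : seq T) (z : T).

(** Occurrences of a in a prefix, counted as if a word missing the first a were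
    completed in front whenever z comes before a; with this shift every letter
    alternating with z stays between the count of z and its successor. *)
Definition level (a : T) (n : nat) := occ a w n + ~~ leads a z w.

Definition level_le (a b : T) := forall n, level a n <= level b n.

Lemma level_bounds a n : a != z -> alternating a z w ->
  occ z w n <= level a n <= (occ z w n).+1.
Proof.
move=> az; rewrite alternating_leads // /level => H.
case: (boolP (leads a z w)) H => [/(leadsP _ az)/(_ n)|_ /=]; first by rewrite addn0.
by rewrite eq_sym in az; move=> /(leadsP _ az)/(_ n); lia.
Qed.

(** All levels lie in a window of width one, so two of them differ by at most
    one in absolute value, and alternation means that the difference keeps its
    sign. *)
Lemma alternating_level a b : a != z -> b != z -> a != b ->
  alternating a z w -> alternating b z w ->
  alternating a b w <-> level_le a b \/ level_le b a.
Proof.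
move=> az bz ab Az Bz; have ba : b != a by rewrite eq_sym.
rewrite alternating_leads //.
have HA n := level_bounds n az Az; have HB n := level_bounds n bz Bz.
split=> [/orP[/(leadsP _ ab)|/(leadsP _ ba)] H|].
- case: (leqP (~~ leads b z w) (~~ leads a z w)) => t; [right|left] => n;
    by move: (H n) t; rewrite /level; lia.
- case: (leqP (~~ leads a z w) (~~ leads b z w)) => t; [left|right] => n;
    by move: (H n) t; rewrite /level; lia.
wlog: a b az bz ab ba Az Bz HA HB / level_le a b.
  move=> W [] H; first by apply: (W a b) => //; left.
  by rewrite orbC; apply: (W b a) => //; left.
move=> H _; have H0 := H 0; rewrite /level /occ !take0 /= in H0.
have [t|t] : ~~ leads a z w = ~~ leads b z w \/
   (~~ leads a z w = 0 :> nat /\ ~~ leads b z w = 1 :> nat) by lia.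
  apply/orP; right; apply/(leadsP _ ba) => n.
  by move: (HA n) (HB n) (H n); rewrite /level t; lia.
apply/orP; left; apply/(leadsP _ ab) => n.
by move: (HA n) (HB n) (H n); rewrite /level t.1 t.2; lia.
Qed.
End Apex.

(** In a comparability graph, two edges that share a vertex and whose other ends
    are not adjacent both go up or both go down at the common vertex.  Once e1 is below e2, this
    forces the direction of all other edges of the prism until the edge between
    e3 and f3 can go in neither direction. *)
Lemma prism_not_comparability (T : Type) (le : T -> T -> Prop)
    (e1 e2 e3 f1 f2 f3 : T) :
  (forall a b c, le a b -> le b c -> le a c) ->
  let cmp a b := le a b \/ le b a in
  [/\ cmp e1 e2, cmp e1 e3 & cmp e2 e3] ->
  [/\ cmp f1 f2, cmp f1 f3 & cmp f2 f3] ->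
  [/\ cmp e1 f1, cmp e2 f2 & cmp e3 f3] ->
  [/\ ~ cmp e1 f2, ~ cmp e1 f3 & ~ cmp e2 f3] ->
  [/\ ~ cmp e2 f1, ~ cmp e3 f1 & ~ cmp e3 f2] -> False.
Proof.
move=> tr cmp; rewrite /cmp {cmp}.
wlog: le tr / le e1 e2.
  move=> W E F D N1 N2; case: (E) => -[E12|E21] E13 E23; first exact: (W le).
  have H : forall A B : Prop, A \/ B -> B \/ A by tauto.
  apply: (W (fun a b => le b a)) => [a b c ab bc|//| | | | |]; first exact: tr bc ab.
  - by split; auto.
  - by case: F; split; auto.
  - by case: D; split; auto.
  - by case: N1; split; auto.
  - by case: N2; split; auto.
move=> e12 [_ E13 E23] [F12 F13 F23] [D1 D2 D3] [N12 N13 N23] [N21 N31 N32].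
have f2e2 : le f2 e2 by case: D2 => // h; case: N12; left; apply: tr h.
have f21 : le f2 f1 by case: F12 => // h; case: N21; right; apply: tr f2e2.
have f23 : le f2 f3 by case: F23 => // h; case: N23; right; apply: tr f2e2.
have e1f1 : le e1 f1 by case: D1 => // h; case: N21; right; apply: tr e12.
have e13 : le e1 e3 by case: E13 => // h; case: N31; left; apply: tr e1f1.
have e32 : le e3 e2 by case: E23 => // h; case: N32; right; apply: tr h.
have f31 : le f3 f1 by case: F13 => // h; case: N13; left; apply: tr h.
case: D3 => h; first by case: N31; left; apply: tr f31.
by case: N23; right; apply: tr e32.
Qed.

(** * Chord diagrams *)

Lemma occ_notin (T : eqType) (v : T) (w : seq T) n : count_mem v w = 0 -> occ v w n = 0.
Proof. rewrite /occ -{1}(cat_take_drop n w) count_cat; lia. Qed.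

Lemma occ_once (T : eqType) (v : T) (w : seq T) : count_mem v w = 1 ->
  exists2 p, onth w p = Some v & forall n, occ v w n = (p < n).
Proof.
elim: w => //= c w IH; case: (eqVneq c v) => [->|cv] /= H.
  exists 0 => // -[|n] //; rewrite /occ /= eqxx.
  by have := @occ_notin _ v w n; rewrite /occ => ->; lia.
have [|p pv pn] := IH; first by lia.
by exists p.+1 => // -[|n] //; rewrite /occ /= (negPf cv) -/(occ _ _ _) pn.
Qed.

Lemma occ_twice (T : eqType) (v : T) (w : seq T) : count_mem v w = 2 ->
  exists p : nat * nat, [/\ p.1 < p.2, onth w p.1 = Some v, onth w p.2 = Some v &
    forall n, occ v w n = (p.1 < n) + (p.2 < n)].
Proof.
elim: w => //= c w IH; case: (eqVneq c v) => [->|cv] /= H.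
  have [|p pv pn] := @occ_once _ v w; first by lia.
  exists (0, p.+1); split=> // -[|n] //; rewrite /occ /= eqxx -/(occ _ _ _) pn; lia.
have [|[p q] /= [pq pv qv pn]] := IH; first by lia.
by exists (p.+1, q.+1); split=> // -[|n] //; rewrite /occ /= (negPf cv) -/(occ _ _ _) pn.
Qed.

(** A chord is the pair of positions of its two ends, the smaller one first. *)
Definition crosses (c d : nat * nat) :=
  (c.1 < d.1 < c.2) && (c.2 < d.2) || (d.1 < c.1 < d.2) && (d.2 < c.2).

Definition disjoint_ends (c d : nat * nat) :=
  [&& c.1 != d.1, c.1 != d.2, c.2 != d.1 & c.2 != d.2].

Lemma alternating_crosses (T : eqType) (w : seq T) (a b : T) (p q : nat * nat) :
  a != b -> p.1 < p.2 -> q.1 < q.2 -> disjoint_ends p q ->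
  (forall n, occ a w n = (p.1 < n) + (p.2 < n)) ->
  (forall n, occ b w n = (q.1 < n) + (q.2 < n)) ->
  alternating a b w = crosses p q.
Proof.
move=> ab; have ba : b != a by rewrite eq_sym.
case: p q => p1 p2 [q1 q2] /= p12 q12 pq Ha Hb.
rewrite /disjoint_ends /= in pq.
rewrite alternating_leads // /crosses /=; apply/idP/idP.
  case/orP=> [/(leadsP _ ab)|/(leadsP _ ba)] H; move: (H p1.+1) (H p2.+1) (H q1.+1) (H q2.+1);
    rewrite !Ha !Hb; lia.
case/orP=> H; apply/orP; [left; apply/(leadsP _ ab)|right; apply/(leadsP _ ba)] => n;
  rewrite Ha Hb; lia.
Qed.

(** In a 2-uniform word each letter is a chord between its two positions, and
    alternation of two letters is crossing of the chords. *)
Lemma two_uniform_chords (G : sgraph) (w : seq G) : uniform 2 w -> represents w ->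
  exists pos : G -> nat * nat,
    [/\ forall v, (pos v).1 < (pos v).2,
        forall u v, u != v -> disjoint_ends (pos u) (pos v) &
        forall u v, u != v -> adj u v = crosses (pos u) (pos v)].
Proof.
move=> w2 /representsP[_ w_adj].
have [pos posP] := fin_all_exists (fun v => occ_twice (w2 v)).
have dis u v : u != v -> disjoint_ends (pos u) (pos v).
  have [_ u1 u2 _] := posP u; have [_ v1 v2 _] := posP v.
  have ne p q : u != v -> onth w p = Some u -> onth w q = Some v -> p != q.
    by move=> uv pu qv; apply: contraNneq uv => e; move: pu; rewrite e qv => -[->].
  by move=> uv; rewrite /disjoint_ends !ne.
exists pos; split=> // [v|u v uv]; first by case: (posP v).
have [u12 _ _ Hu] := posP u; have [v12 _ _ Hv] := posP v.
by rewrite w_adj //; apply: alternating_crosses => //; apply: dis.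
Qed.

Section Hexagon.
Variables e1 e2 e3 : nat * nat.
Hypothesis e_hexagon :
  [&& e1.1 < e2.1, e2.1 < e3.1, e3.1 < e1.2, e1.2 < e2.2 & e2.2 < e3.2].

(** The six ends of e1, e2, e3 cut the circle into arcs, numbered by how many
    ends come before; since the positions lie on a line, the arcs 0 and 6 are
    the same arc of the circle. *)
Definition sector (n : nat) : nat :=
  (e1.1 < n) + (e2.1 < n) + (e3.1 < n) + (e1.2 < n) + (e2.2 < n) + (e3.2 < n).

Definition sectors (c : nat * nat) := (sector c.1, sector c.2).

(** The ends of the k-th of the three chords lie just before the arcs k and
    k + 3, so crossing that chord is a matter of arcs. *)
Definition separates (k : nat) (s : nat * nat) :=
  (s.1 < k <= s.2) && (s.2 < k + 3) || (k <= s.1 < k + 3) && (k + 3 <= s.2).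

(** Crossing chords satisfy this weak inequality on arcs, where ends in the same
    arc are not ordered. *)
Definition may_cross (s t : nat * nat) :=
  (s.1 <= t.1 <= s.2) && (s.2 <= t.2) || (t.1 <= s.1 <= t.2) && (t.2 <= s.2).

Definition in_sectors (l : seq nat) (s : nat * nat) := (s.1 \in l) && (s.2 \in l).

(** Both ends lie in the two arcs next to one end of the k-th chord. *)
Definition near (k : nat) (s : nat * nat) :=
  match k with
  | 1 => in_sectors [:: 6; 0; 1] s || in_sectors [:: 3; 4] s
  | 2 => in_sectors [:: 1; 2] s || in_sectors [:: 4; 5] s
  | _ => in_sectors [:: 2; 3] s || in_sectors [:: 5; 6; 0] s
  end.

Definition sector_pairs :=
  [seq s <- [seq (i, j) | i <- iota 0 7, j <- iota 0 7] | s.1 <= s.2].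

Definition unseparated s := [&& ~~ separates 1 s, ~~ separates 2 s & ~~ separates 3 s].

Definition separated_only_by k s :=
  all (fun h => separates h s == (h == k)) [:: 1; 2; 3].

(** The arcs form a finite set, so this and the next two facts are checked by
    enumeration. *)
Lemma near_start k s : k \in [:: 1; 2; 3] -> s \in sector_pairs ->
  separated_only_by k s -> near k s.
Proof.
move=> k3 s_in H.
have /allP/(_ k k3)/allP/(_ s s_in) : all (fun k => all (fun s =>
  separated_only_by k s ==> near k s) sector_pairs) [:: 1; 2; 3] by vm_compute.
by rewrite H.
Qed.

Lemma near_step k s t : k \in [:: 1; 2; 3] -> s \in sector_pairs -> t \in sector_pairs ->
  unseparated t -> may_cross s t -> near k s -> near k t.
Proof.
move=> k3 s_in t_in H1 H2 H3.
have /allP/(_ k k3)/allP/(_ s s_in)/allP/(_ t t_in) : all (fun k => all (fun s => all (fun t =>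
  [&& unseparated t, may_cross s t & near k s] ==> near k t)
  sector_pairs) sector_pairs) [:: 1; 2; 3] by vm_compute.
by rewrite H1 H2 H3.
Qed.

(** Crossing chords share an arc, and the six ends of e1, e2, e3 contain no three
    that pairwise bound a common arc, just as a hexagon has no triangle. *)
Lemma near_not_all_cross s t u :
  s \in sector_pairs -> t \in sector_pairs -> u \in sector_pairs ->
  near 1 s -> near 2 t -> near 3 u ->
  may_cross s t -> may_cross s u -> may_cross t u -> False.
Proof.
move=> s_in t_in u_in s1 t2 u3 st su tu.
pose near_pairs k := [seq s <- sector_pairs | near k s].
have : all (fun s => all (fun t => all (fun u =>
    ~~ [&& may_cross s t, may_cross s u & may_cross t u])
  (near_pairs 3)) (near_pairs 2)) (near_pairs 1) by vm_compute.
have near_in k p : p \in sector_pairs -> near k p -> p \in near_pairs k.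
  by move=> p_in pk; rewrite mem_filter pk.
move=> /allP/(_ s (near_in _ _ s_in s1))/allP/(_ t (near_in _ _ t_in t2)).
move=> /allP/(_ u (near_in _ _ u_in u3)).
by rewrite st su tu.
Qed.

Lemma sector_mono m n : m <= n -> sector m <= sector n.
Proof. rewrite /sector; lia. Qed.

Lemma sectors_pair c : c.1 < c.2 -> sectors c \in sector_pairs.
Proof.
move=> c12; rewrite mem_filter; apply/andP; split; first exact: sector_mono (ltnW c12).
by apply/allpairsP; exists (sectors c); split=> //; rewrite mem_iota /= /sector; lia.
Qed.

Lemma sectorE n : [/\ (0 < sector n) = (e1.1 < n), (1 < sector n) = (e2.1 < n),
  (2 < sector n) = (e3.1 < n) & [/\ (3 < sector n) = (e1.2 < n),
  (4 < sector n) = (e2.2 < n) & (5 < sector n) = (e3.2 < n)]].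
Proof. by rewrite /sector; split; [lia|lia|lia|split; lia]. Qed.

Lemma crosses_may c d : c.1 < c.2 -> d.1 < d.2 -> crosses c d ->
  may_cross (sectors c) (sectors d).
Proof.
move=> c12 d12 /orP[]/andP[/andP[h1 h2] h3]; apply/orP; [left|right];
  by rewrite /= !sector_mono // ltnW.
Qed.

Lemma crosses_separates c : c.1 < c.2 ->
  [/\ disjoint_ends c e1 -> crosses c e1 = separates 1 (sectors c),
      disjoint_ends c e2 -> crosses c e2 = separates 2 (sectors c) &
      disjoint_ends c e3 -> crosses c e3 = separates 3 (sectors c)].
Proof.
have [a1 a2 a3 [a4 a5 a6]] := sectorE c.1.
have [b1 b2 b3 [b4 b5 b6]] := sectorE c.2.
rewrite /separates /crosses /disjoint_ends /=.
move: (sector c.1) (sector c.2) a1 a2 a3 a4 a5 a6 b1 b2 b3 b4 b5 b6 => s t *.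
split; lia.
Qed.

End Hexagon.

Section ThreeArms.
Variables (G : sgraph) (I : eqType) (len : I -> nat) (lab : G -> I * nat).
Hypothesis lab_valid : forall v, (lab v).2 < len (lab v).1.
Hypothesis lab_surj : forall p : I * nat, p.2 < len p.1 -> exists v, lab v = p.
Hypothesis lab_adj : forall u v, u != v -> adj u v = edge_adj len (lab u) (lab v).

Variable pos : G -> nat * nat.
Hypothesis pos_lt : forall v, (pos v).1 < (pos v).2.
Hypothesis pos_disjoint : forall u v, u != v -> disjoint_ends (pos u) (pos v).
Hypothesis pos_adj : forall u v, u != v -> adj u v = crosses (pos u) (pos v).

Lemma label_crosses u v : lab u != lab v ->
  crosses (pos u) (pos v) = edge_adj len (lab u) (lab v).
Proof.
move=> uv; have ne : u != v by apply: contraNneq uv => ->.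
by rewrite -pos_adj // lab_adj.
Qed.

(** The first edges of three long paths, in the order of their first ends, make a
    hexagon; the chords of each path remain near its first edge up to its last
    edge, where the three paths cross pairwise. *)
Lemma sorted_arms i1 i2 i3 (e1 e2 e3 : G) :
  [/\ 1 < len i1, 1 < len i2 & 1 < len i3] ->
  [/\ i1 != i2, i1 != i3 & i2 != i3] ->
  [/\ lab e1 = (i1, 0), lab e2 = (i2, 0) & lab e3 = (i3, 0)] ->
  (pos e1).1 < (pos e2).1 < (pos e3).1 -> False.
Proof.
move=> [l1 l2 l3] [i12 i13 i23] [le1 le2 le3] /andP[e12 e23].
have [i21 i31 i32] : [/\ i2 != i1, i3 != i1 & i3 != i2].
  by rewrite ![i2 == _]eq_sym ![i3 == _]eq_sym.
(* Pairwise crossing turns the order of the first ends into the order of all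
   six. *)
have hex : [&& (pos e1).1 < (pos e2).1, (pos e2).1 < (pos e3).1, (pos e3).1 < (pos e1).2,
               (pos e1).2 < (pos e2).2 & (pos e2).2 < (pos e3).2].
  have c12 : crosses (pos e1) (pos e2).
    by rewrite label_crosses le1 le2 ?xpair_eqE ?(negPf i12) // /edge_adj /= (negPf i12).
  have c13 : crosses (pos e1) (pos e3).
    by rewrite label_crosses le1 le3 ?xpair_eqE ?(negPf i13) // /edge_adj /= (negPf i13).
  have c23 : crosses (pos e2) (pos e3).
    by rewrite label_crosses le2 le3 ?xpair_eqE ?(negPf i23) // /edge_adj /= (negPf i23).
  by move: c12 c13 c23; rewrite /crosses; lia.
pose sec v := sectors (pos e1) (pos e2) (pos e3) (pos v).
have sec_in v : sec v \in sector_pairs by apply: sectors_pair.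
have cross_sec u v : lab u != lab v -> edge_adj len (lab u) (lab v) -> may_cross (sec u) (sec v).
  by move=> uv; rewrite -label_crosses //; apply: crosses_may.
have sep v i j : lab v = (i, j.+1) ->
  [/\ separates 1 (sec v) = (i == i1) && (j == 0), separates 2 (sec v) = (i == i2) && (j == 0)
     & separates 3 (sec v) = (i == i3) && (j == 0)].
  move=> lv; have vl := lab_valid v; rewrite lv /= in vl.
  have ne e h : lab e = (h, 0) -> lab v != lab e by move=> ->; rewrite lv xpair_eqE andbF.
  have dis e h : lab e = (h, 0) -> disjoint_ends (pos v) (pos e).
    by move=> /ne ve; apply: pos_disjoint; apply: contraNneq ve => ->.
  have cr e h : lab e = (h, 0) -> 1 < len h -> crosses (pos v) (pos e) = (i == h) && (j == 0).
    move=> he hl; rewrite label_crosses ?(ne _ _ he) // lv he /edge_adj /=.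
    by have [ih|ih] /= := eqVneq i h; lia.
  have [s1 s2 s3] := crosses_separates hex (pos_lt v).
  split; [rewrite -s1|rewrite -s2|rewrite -s3]; by [apply: cr le1 l1|apply: cr le2 l2|apply: cr le3 l3
    |apply: dis le1|apply: dis le2|apply: dis le3].
clearbody sec.
have arm k i : k \in [:: 1; 2; 3] ->
    (forall v j, lab v = (i, j.+1) ->
       all (fun h => separates h (sec v) == (h == k) && (j == 0)) [:: 1; 2; 3]) ->
    forall j v, lab v = (i, j.+1) -> near k (sec v).
  move=> k3 sep_k; elim=> [|j IH] v lv.
    by apply: near_start => //; apply: sub_all (sep_k v _ lv) => h; rewrite andbT.
  have vl := lab_valid v; rewrite lv /= in vl.
  have [u lu] : exists u, lab u = (i, j.+1) by apply: lab_surj; apply: ltnW.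
  apply: (near_step k3 (sec_in u) (sec_in v)) (IH u lu).
    by have := sep_k v _ lv; rewrite /unseparated /= !andbF => /and4P[/eqP-> /eqP-> /eqP->].
  by apply: cross_sec; rewrite lu lv ?xpair_eqE /edge_adj /= eqxx; lia.
have last_edge i : 1 < len i -> exists v, lab v = (i, (len i).-2.+1).
  by move=> li; apply: lab_surj => /=; lia.
have [f1 lf1] := last_edge _ l1; have [f2 lf2] := last_edge _ l2; have [f3 lf3] := last_edge _ l3.
have ends u v h i : lab u = (h, (len h).-2.+1) -> lab v = (i, (len i).-2.+1) ->
    h != i -> 1 < len h -> 1 < len i -> may_cross (sec u) (sec v).
  move=> lu lv hi hl il; apply: cross_sec; rewrite lu lv ?xpair_eqE /edge_adj /= (negPf hi) //.
  by lia.
apply: (near_not_all_cross (sec_in f1) (sec_in f2) (sec_in f3)).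
- apply: (arm 1 i1) lf1 => // v j lv; have [s1 s2 s3] := sep v _ _ lv.
  by rewrite /= s1 s2 s3 ?eqxx ?(negPf i12) ?(negPf i13) ?(negPf i23)
    ?(negPf i21) ?(negPf i31) ?(negPf i32) !eqxx.
- apply: (arm 2 i2) lf2 => // v j lv; have [s1 s2 s3] := sep v _ _ lv.
  by rewrite /= s1 s2 s3 ?eqxx ?(negPf i12) ?(negPf i13) ?(negPf i23)
    ?(negPf i21) ?(negPf i31) ?(negPf i32) !eqxx.
- apply: (arm 3 i3) lf3 => // v j lv; have [s1 s2 s3] := sep v _ _ lv.
  by rewrite /= s1 s2 s3 ?eqxx ?(negPf i12) ?(negPf i13) ?(negPf i23)
    ?(negPf i21) ?(negPf i31) ?(negPf i32) !eqxx.
- exact: ends lf1 lf2 _ _ _.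
- exact: ends lf1 lf3 _ _ _.
- exact: ends lf2 lf3 _ _ _.
Qed.

Lemma no_three_arms i1 i2 i3 :
  [/\ 1 < len i1, 1 < len i2 & 1 < len i3] ->
  [/\ i1 != i2, i1 != i3 & i2 != i3] -> False.
Proof.
move=> [l1 l2 l3] [i12 i13 i23].
have [i21 i31 i32] : [/\ i2 != i1, i3 != i1 & i3 != i2].
  by rewrite ![i2 == _]eq_sym ![i3 == _]eq_sym.
have first_edge i : 1 < len i -> exists v, lab v = (i, 0) by move=> li; apply: lab_surj => /=; lia.
have [e1 le1] := first_edge _ l1; have [e2 le2] := first_edge _ l2; have [e3 le3] := first_edge _ l3.
have ne u v h i : lab u = (h, 0) -> lab v = (i, 0) -> h != i -> (pos u).1 != (pos v).1.
  move=> lu lv hi; have /pos_disjoint/andP[] // : u != v.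
  by apply: contraNneq hi => uv; move: lu; rewrite uv lv => -[->].
have n12 := ne _ _ _ _ le1 le2 i12; have n13 := ne _ _ _ _ le1 le3 i13.
have n23 := ne _ _ _ _ le2 le3 i23.
have ordered f g h : (pos f).1 != (pos g).1 -> (pos f).1 != (pos h).1 -> (pos g).1 != (pos h).1 ->
    [|| (pos f).1 < (pos g).1 < (pos h).1, (pos f).1 < (pos h).1 < (pos g).1,
     (pos g).1 < (pos f).1 < (pos h).1, (pos g).1 < (pos h).1 < (pos f).1,
     (pos h).1 < (pos f).1 < (pos g).1 | (pos h).1 < (pos g).1 < (pos f).1].
  by move: (pos f).1 (pos g).1 (pos h).1 => p q r; lia.
case/or4P: (ordered e1 e2 e3 n12 n13 n23) => [||| /or3P[]];
  by [apply: (@sorted_arms i1 i2 i3)|apply: (@sorted_arms i1 i3 i2)|apply: (@sorted_arms i2 i1 i3)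
     |apply: (@sorted_arms i2 i3 i1)|apply: (@sorted_arms i3 i1 i2)|apply: (@sorted_arms i3 i2 i1)].
Qed.
End ThreeArms.

(** * The representation number *)

Lemma one_representable_complete (G : sgraph) (u v : G) :
  k_representable G 1 -> u != v -> adj u v.
Proof.
move=> [w w1 /representsP[_ w_adj]] uv; rewrite w_adj //.
have vu : v != u by rewrite eq_sym.
have [p _ Hu] := occ_once (w1 u); have [q _ Hv] := occ_once (w1 v).
rewrite alternating_leads //; case: (leqP p q) => pq; apply/orP; [left|right].
  by apply/(leadsP _ uv) => n; rewrite Hu Hv; lia.
by apply/(leadsP _ vu) => n; rewrite Hu Hv; lia.
Qed.

Section Melon.
Variables (M : sgraph) (m : nat) (x y : M) (P : 'I_m -> seq M).
Hypothesis hM : melon x y P.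
Let G := line_graph M.
Let len (i : 'I_m) := size (P i).
Variable lab : G -> 'I_m * nat.
Hypothesis lab_inj : injective lab.
Hypothesis lab_valid : forall A, (lab A).2 < len (lab A).1.
Hypothesis lab_surj : forall p, p.2 < len p.1 -> exists A, lab A = p.
Hypothesis lab_adj : forall A B, A != B -> adj A B = edge_adj len (lab A) (lab B).

Lemma len_gt0 i : 0 < len i.
Proof.
rewrite lt0n; apply: contraNneq (melon_ends hM) => /size0nil Pi.
by have [_ <- _] := melon_path hM i; rewrite Pi.
Qed.

(** The paths of a word may be more numerous than those of the graph: f selects
    the ones that are used. *)
Lemma k_representable_relabel (n k : nat) (len' : nat -> nat)
    (w : seq (nat * nat)) (f : 'I_m -> nat) :
  injective f -> (forall i, f i < n) -> (forall i, len' (f i) = len i) ->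
  0 < k -> represents_labels n len' k w -> k_representable G k.
Proof.
move=> f_inj f_lt f_len k0 hw.
apply: (@k_representable_labels G n len' k w (fun A => (f (lab A).1, (lab A).2))) => //.
- move=> A B [/f_inj e1 e2]; apply: lab_inj.
  by rewrite [lab A]surjective_pairing [lab B]surjective_pairing e1 e2.
- by move=> A /=; rewrite f_len.
- by move=> A B AB; rewrite lab_adj // /edge_adj /= (inj_eq f_inj) !f_len.
Qed.

Definition long := [set i | 2 <= len i].

Lemma long_not_le2 k : 3 <= #|long| -> k <= 2 -> ~ k_representable G k.
Proof.
case/card_gt2P=> i1 [i2] [i3] [[]]; rewrite !inE => l1 l2 l3 [i12 i23 i31] k2.
have [e1 le1] := @lab_surj (i1, 0) (len_gt0 i1).
have [f2 lf2] := @lab_surj (i2, 1) l2.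
case: k k2 => [|[|[|//]]] _.
- by move=> [w w0 [/(_ e1) w_e1 _]]; move: w_e1; rewrite -has_pred1 has_count w0.
- have ne : e1 != f2 by apply: contraNneq i12 => e; move: le1; rewrite e lf2 => -[->].
  move=> /one_representable_complete/(_ ne); rewrite lab_adj // le1 lf2 /edge_adj /= (negPf i12).
  by have : len i1 != 1 by [lia]; case: (len i1) => [|[|]].
- move=> [w w2 w_rep]; have [pos [pos_lt pos_dis pos_adj]] := two_uniform_chords w2 w_rep.
  apply: (@no_three_arms G _ len lab lab_valid lab_surj lab_adj
    pos pos_lt pos_dis pos_adj i1 i2 i3) => //.
  by split=> //; rewrite eq_sym.
Qed.

Definition nth_len t := nth 0 [seq len i | i <- enum 'I_m] t.

Lemma nth_lenE (i : 'I_m) : nth_len i = len i.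
Proof. by rewrite /nth_len (nth_map i) ?size_enum_ord // nth_ord_enum. Qed.

Lemma three_rep_no_short : (forall i, len i != 1) -> k_representable G 3.
Proof.
move=> no1; apply: (@k_representable_relabel m 3 nth_len (chordless_word m nth_len) (@nat_of_ord m)) => //.
- exact: ord_inj.
- exact: nth_lenE.
- apply: chordless_word_represents => i im.
  by rewrite (nth_lenE (Ordinal im)); have := len_gt0 (Ordinal im); have := no1 (Ordinal im); lia.
Qed.

Lemma two_rep : #|long| <= 2 -> k_representable G 2.
Proof.
move=> long2.
pose f i := if len i == 1 then 0 else (index i (enum long)).+1.
(* Paths of the word that are absent from the graph get the least length that
   the word allows. *)
pose len' t :=
  if t is u.+1 then maxn 2 (nth 0 [seq len i | i <- enum long] u) else 1.
have f_long i : len i != 1 -> i \in enum long.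
  by rewrite mem_enum inE; have := len_gt0 i; lia.
apply: (@k_representable_relabel 3 2 len' (theta_word len') f) => //.
- move=> i j; rewrite /f; case: eqP => i1; case: eqP => j1 //.
    by move=> _; apply: (melon_length1 hM).
  case=> e; apply: (index_inj i) e; exact/f_long/eqP.
- move=> i; rewrite /f; case: eqP => // /eqP/f_long; rewrite -index_mem -cardE.
  by move=> h; rewrite ltnS; apply: leq_trans h long2.
- move=> i; rewrite /f; case: eqP => [->//|/eqP i1] /=.
  have il := f_long i i1; rewrite (nth_map i) ?index_mem // nth_index //.
  by apply/maxn_idPr; have := len_gt0 i; lia.
- by apply: theta_word_represents; rewrite /len' // leq_max.
Qed.

(** The path of length one goes to path 0 of the word, those of length two to the
    paths 1 and 2, and the i-th path to 3 + i otherwise. *)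
Lemma three_rep_short : #|[set i | len i == 2]| <= 2 -> k_representable G 3.
Proof.
set two := [set i | len i == 2] => two2.
pose f (i : 'I_m) := if len i == 1 then 0 else if len i == 2 then (index i (enum two)).+1
  else i.+3.
(* Paths of the word that are absent from the graph get the least length that
   the word allows. *)
pose len' t := match t with 0 => 1 | 1 => 2 | 2 => 2 | u.+3 => maxn 3 (nth_len u) end.
have f_two i : len i = 2 -> (index i (enum two)) < 2.
  by move=> i2; apply: leq_trans two2; rewrite cardE index_mem mem_enum inE i2.
apply: (@k_representable_relabel (3 + m) 3 len' (chord_word m len') f) => //.
- move=> i j; rewrite /f.
  have [i1|i1] := eqVneq (len i) 1; have [j1|j1] := eqVneq (len j) 1.
  + by move=> _; apply: (melon_length1 hM).
  + by case: ifP.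
  + by case: ifP.
  have [i2|i2] := eqVneq (len i) 2; have [j2|j2] := eqVneq (len j) 2.
  + by case=> e; apply: (index_inj i) e; rewrite mem_enum inE; apply/eqP.
  + by move: (f_two i i2) => h [e]; rewrite e in h.
  + by move: (f_two j j2) => h [e]; rewrite -e in h.
  + by case=> /ord_inj.
- move=> i; rewrite /f; case: eqP => // _; case: eqP => [/f_two|_]; have := ltn_ord i; lia.
- move=> i; rewrite /f; case: eqP => [->//|i1]; case: eqP => [i2|i2].
    by rewrite i2 /len'; case: (index _ _) (f_two i i2) => [|[|]].
  rewrite /len' nth_lenE; apply/maxn_idPr; have := len_gt0 i; lia.
- by apply: chord_word_represents => // -[|[|[|i]]] //= _; rewrite leq_max.
Qed.

(** Three paths of length two would give six neighbours of z inducing a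
    triangular prism. *)
Lemma few_length_two (z : 'I_m) : len z = 1 -> word_representable G ->
  #|[set i | len i == 2]| <= 2.
Proof.
move=> z1 [w /representsP[_ w_adj]]; rewrite leqNgt; apply/negP.
case/card_gt2P=> i1 [i2] [i3] [[]]; rewrite !inE => /eqP l1 /eqP l2 /eqP l3 [i12 i23 i31].
have i13 : i1 != i3 by rewrite eq_sym.
have ztw i : len i = 2 -> i != z by move=> i2'; apply: contra_eqN i2' => /eqP->; rewrite z1.
have [c lc] := @lab_surj (z, 0) (len_gt0 z).
have first i : len i = 2 -> exists A, lab A = (i, 0) by move=> l; apply: lab_surj; rewrite /= l.
have last i : len i = 2 -> exists A, lab A = (i, 1) by move=> l; apply: lab_surj; rewrite /= l.
have [e1 he1] := first _ l1; have [e2 he2] := first _ l2; have [e3 he3] := first _ l3.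
have [f1 hf1] := last _ l1; have [f2 hf2] := last _ l2; have [f3 hf3] := last _ l3.
have [z_1 z_2 z_3] := And3 (ztw _ l1) (ztw _ l2) (ztw _ l3).
have cmpE A B i j k l : lab A = (i, j) -> lab B = (k, l) -> len i = 2 -> len k = 2 -> (i, j) != (k, l) ->
  (level_le w c A B \/ level_le w c B A) <-> edge_adj len (i, j) (k, l).
  move=> hA hB li lk ne.
  have AB : A != B by apply: contraNneq ne => e; rewrite -hA -hB e.
  have nz D u v : lab D = (u, v) -> len u = 2 -> D != c /\ alternating D c w.
    move=> hD lu; have uz := ztw _ lu; have Dc : D != c.
      by apply: contraNneq uz => e; move: hD; rewrite e lc => -[->].
    split=> //; rewrite -w_adj // lab_adj // hD lc /edge_adj /= (negPf uz) z1 lu.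
    by have := lab_valid D; rewrite hD /= lu; case: v {hD} => [|[|]].
  have [Ac Aw] := nz A i j hA li; have [Bc Bw] := nz B k l hB lk.
  have -> : edge_adj len (i, j) (k, l) = alternating A B w.
    by rewrite -hA -hB -(lab_adj AB); apply: w_adj.
  by apply: iff_sym; apply: alternating_level.
have tr A B D : level_le w c A B -> level_le w c B D -> level_le w c A D.
  by move=> AB BD n; apply: leq_trans (AB n) (BD n).
have [i21 i32] : i2 != i1 /\ i3 != i2 by rewrite [i2 == i1]eq_sym [i3 == i2]eq_sym.
have first_adj A B i k : lab A = (i, 0) -> lab B = (k, 0) -> len i = 2 -> len k = 2 -> i != k ->
    level_le w c A B \/ level_le w c B A.
  by move=> hA hB li lk ik; apply/(cmpE _ _ _ _ _ _ hA hB) => //;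
    rewrite ?xpair_eqE /edge_adj /= (negPf ik).
have last_adj A B i k : lab A = (i, 1) -> lab B = (k, 1) -> len i = 2 -> len k = 2 -> i != k ->
    level_le w c A B \/ level_le w c B A.
  by move=> hA hB li lk ik; apply/(cmpE _ _ _ _ _ _ hA hB) => //;
    rewrite ?xpair_eqE /edge_adj /= (negPf ik) ?li ?lk.
have rung A B i : lab A = (i, 0) -> lab B = (i, 1) -> len i = 2 ->
    level_le w c A B \/ level_le w c B A.
  by move=> hA hB li; apply/(cmpE _ _ _ _ _ _ hA hB) => //;
    rewrite ?xpair_eqE ?andbF // /edge_adj /= eqxx.
have apart A B i k : lab A = (i, 0) -> lab B = (k, 1) -> len i = 2 -> len k = 2 -> i != k ->
    ~ (level_le w c A B \/ level_le w c B A).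
  move=> hA hB li lk ik; rewrite (cmpE _ _ _ _ _ _ hA hB) //; last by rewrite xpair_eqE (negPf ik).
  by rewrite /edge_adj /= (negPf ik) li.
apply: (@prism_not_comparability _ (level_le w c) e1 e2 e3 f1 f2 f3 tr); split;
  by [apply: first_adj; eassumption | apply: last_adj; eassumption
     | apply: rung; eassumption | apply: apart; eassumption].
Qed.
End Melon.

Theorem theorem10 (M : sgraph) (m : nat) (x y : M) (P : 'I_m -> seq M)
    (hM : melon x y P) (hL : word_representable (line_graph M)) :
  exists r : nat,
    is_representation_number (line_graph M) r /\
    r <= 3 /\
    (r = 3 <-> 3 <= #|[set i : 'I_m | 2 <= size (P i)]|).
Proof.
have [lab [lab_inj lab_valid lab_surj lab_adj]] := melon_labelling hM.
case: (leqP 3 #|[set i : 'I_m | 2 <= size (P i)]|) => long3.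
  exists 3; split=> //; split=> [|j].
    have [/existsP[z /eqP z1]|no1] := boolP [exists i, size (P i) == 1].
      apply: (three_rep_short hM lab_inj lab_valid lab_adj).
      exact: (few_length_two hM lab_valid lab_surj lab_adj z1).
    apply: (three_rep_no_short hM lab_inj lab_valid lab_adj) => i.
    by move/existsPn: no1; apply.
  move=> j_rep; rewrite leqNgt; apply/negP => j2.
  exact: (long_not_le2 hM lab_valid lab_surj lab_adj long3 j2).
have two := two_rep hM lab_inj lab_valid lab_adj long3.
suff [r [r_rep r_min] r2] : exists2 r, is_representation_number (line_graph M) r & r <= 2.
  by exists r; split=> //; split; [lia | split; [lia | ]].
have [r0|n0] := classic (k_representable (line_graph M) 0); first by exists 0.
have [r1|n1] := classic (k_representable (line_graph M) 1).
  by exists 1 => //; split=> // -[|j].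
by exists 2 => //; split=> // -[|[|j]].
Qed.
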